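(* Let $f_1\in L^2(\Omega_1)$ and $f_2\in L^2(\Omega_2)$. The solution $u=u_1+u_2\in\tilde H^{s_1}(\Omega_1)\oplus\tilde H^{s_2}(\Omega_2)=H$ of $$\mathcal{A}(u,v)=\int_{\Omega_1}f_1v_1\,\mathrm{d}x+\int_{\Omega_2}f_2v_2\,\mathrm{d}x\qquad\forall v=v_1+v_2\in H$$ satisfies the stability bound $$|u_1|_{\tilde H^{s_1}(\Omega_1)}+|u_2|_{\tilde H^{s_2}(\Omega_2)}\le C\left(\|f_1\|_{L^2(\Omega_1)}+\|f_2\|_{L^2(\Omega_2)}\right),$$ with a constant $C>0$ that is independent of $u$, $f_1$, and $f_2$.
   Context: Setting. Let $n\ge 2$, $s_1,s_2\in(0,1)$, and let $\Omega_1,\Omega_2\subset\mathbb{R}^n$ be open, connected, bounded domains with Lipschitz boundaries and $\overline{\Omega}_1\cap\overline{\Omega}_2=\emptyset$; $d:=\mathrm{dist}(\Omega_1,\Omega_2)>0$. $\Omega^c$ denotes the complement of $\Omega$ in $\mathbb{R}^n$. The kernel $J:\mathbb{R}^n\to\mathbb{R}$ is measurable and satisfies: $J(z)\ge 0$ and $J(z)=J(-z)$ for a.e. $z$; $J\in L^1(\mathbb{R}^n)$; there exists $r>d$ such that $B_r(0)\subset\mathrm{supp}(J)$. For $i\in\{1,2\}$, $\mathcal{C}_i=c(n,s_i)/2$, where $c(n,s_i)>0$ is the normalization constant of the fractional Laplacian $(-\Delta)^{s_i}$ on $\mathbb{R}^n$. Spaces. For $s\in(0,1)$, $\tilde H^s(\Omega)$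 is the closure of $C_0^\infty(\Omega)$ in $H^s(\mathbb{R}^n)$ (equivalently, functions of $H^s(\mathbb{R}^n)$ supported in $\overline\Omega$), with norm $|v|_{\tilde H^s(\Omega)}^2=\int_{\mathbb{R}^n}\int_{\mathbb{R}^n}\frac{|v(x)-v(y)|^2}{|x-y|^{n+2s}}\,\mathrm{d}x\,\mathrm{d}y$; its elements vanish outside $\Omega$. $H:=\tilde H^{s_1}(\Omega_1)\oplus\tilde H^{s_2}(\Omega_2)=\{u=u_1+u_2:u_i\in\tilde H^{s_i}(\Omega_i)\}$. Bilinear form. For $u,v\in H$, $$\begin{aligned}\mathcal{A}(u,v)=\ &\mathcal{C}_1\int_{\Omega_2^c}\int_{\Omega_2^c}\frac{(u_1(x)-u_1(y))(v_1(x)-v_1(y))}{|x-y|^{n+2s_1}}\,\mathrm{d}y\,\mathrm{d}x+\mathcal{C}_2\int_{\Omega_1^c}\int_{\Omega_1^c}\frac{(u_2(x)-u_2(y))(v_2(x)-v_2(y))}{|x-y|^{n+2s_2}}\,\mathrm{d}y\,\mathrm{d}x\\&+\int_{\Omega_1}\int_{\Omega_2}J(x-y)(u_1(x)-u_2(y))(v_1(x)-v_2(y))\,\mathrm{d}y\,\mathrm{d}x.\end{aligned}$$ Taking $v_2=0$ and then $v_1=0$, the weak problem is equivalent to a coupled system of two equations, one tested with all $v_1\in\tilde H^{s_1}(\Omega_1)$ and one with all $v_2\in\tilde H^{s_2}(\Omega_2)$. *)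

(* Defs.v *)
From HB Require Import structures.
From mathcomp Require Import all_boot all_order all_algebra.
From mathcomp Require Import all_classical all_reals all_analysis.
Set Implicit Arguments.
Unset Strict Implicit.
Unset Printing Implicit Defensive.
Import Order.TTheory GRing.Theory Num.Theory.
Import numFieldNormedType.Exports.
Local Open Scope classical_set_scope.
Local Open Scope ring_scope.

Section measurable_rV.
Context {R : realType} {n : nat}.

Let coors (i : 'I_n) (x : 'rV[R]_n) : measurableTypeR R := x 0 i.

Let rV_set0 : g_sigma_preimage coors set0.
Proof. exact: sigma_algebra0. Qed.

Let rV_setC A : g_sigma_preimage coors A -> g_sigma_preimage coors (~` A).
Proof. exact: sigma_algebraC. Qed.

Let rV_bigcup (F : _^nat) : (forall i, g_sigma_preimage coors (F i)) ->
  g_sigma_preimage coors (\bigcup_i (F i)).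
Proof. exact: sigma_algebra_bigcup. Qed.

(* The sigma-algebra generated by the coordinate projections, i.e. the product
   sigma-algebra; as the topology of R^n is second countable this is the Borel
   sigma-algebra. *)
HB.instance Definition _ := @isMeasurable.Build default_measure_display
  'rV[R]_n (g_sigma_preimage coors) rV_set0 rV_setC rV_bigcup.

Lemma measurable_coord (i : 'I_n) :
  measurable_fun [set: 'rV[R]_n] (fun x : 'rV[R]_n => x 0 i).
Proof.
move=> _ Y mY; rewrite setTI; apply: sub_sigma_algebra => /=.
rewrite -bigcup_seq/=; exists i => /=; first by rewrite mem_index_enum.
by exists Y => //; rewrite setTI.
Qed.

Lemma measurable_fun_coordP d (T : measurableType d) (f : T -> 'rV[R]_n) :
  (forall i, measurable_fun [set: T] (fun t => f t 0 i)) ->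
  measurable_fun [set: T] f.
Proof.
move=> mf _ A mA; rewrite setTI.
suff: @measurable _ 'rV[R]_n `<=` [set B | measurable (f @^-1` B)] by exact.
apply: smallest_sub.
  split => /=.
  - by rewrite preimage_set0.
  - by move=> B mB; rewrite setTD preimage_setC; exact: measurableC.
  - by move=> F mF; rewrite preimage_bigcup; exact: bigcup_measurable.
move=> B; rewrite -bigcup_seq => -[i _ [Y mY <-]] /=.
rewrite setTI.
by have := mf i measurableT Y mY; rewrite setTI.
Qed.

End measurable_rV.

Section lebesgue_rV_step.
Context {R : realType} {n : nat}.
Variable m : {sigma_finite_measure set 'rV[R]_n -> \bar R}.

Definition rV_cons (p : measurableTypeR R * 'rV[R]_n) : 'rV[R]_n.+1 :=
  \row_i oapp (p.2 0) p.1 (unlift 0 i).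

Definition rV_uncons (x : 'rV[R]_n.+1) : measurableTypeR R * 'rV[R]_n :=
  (x 0 0, col' 0 x).

Lemma rV_consK : cancel rV_cons rV_uncons.
Proof.
move=> [a v]; rewrite /rV_uncons /rV_cons /=; congr pair.
  by rewrite mxE unlift_none.
by apply/rowP => j; rewrite !mxE liftK.
Qed.

Lemma measurable_rV_cons : measurable_fun setT rV_cons.
Proof.
apply: measurable_fun_coordP => i.
case: (unliftP 0 i) => [j|] ->.
  rewrite (_ : (fun t => _) = (fun x : 'rV[R]_n => x 0 j) \o snd); last first.
    by apply/funext => t; rewrite mxE liftK.
  by apply: measurableT_comp => //; exact: measurable_coord.
rewrite (_ : (fun t => _) = fst) //.
by apply/funext => t; rewrite mxE unlift_none.
Qed.

Lemma measurable_rV_uncons : measurable_fun setT rV_uncons.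
Proof.
apply: measurable_fun_pair; first exact: measurable_coord.
apply: measurable_fun_coordP => i.
rewrite (_ : (fun t => _) = (fun x : 'rV[R]_n.+1 => x 0 (lift 0 i))).
  exact: measurable_coord.
by apply/funext => t; rewrite mxE.
Qed.

Definition lebesgue_rV_step : set 'rV[R]_n.+1 -> \bar R :=
  pushforward (@lebesgue_measure R \x m)%E rV_cons.

Let step_measure : {measure set 'rV[R]_n.+1 -> \bar R} :=
  measure_function_pushforward__canonical__measure_function_Measure
    (product_measure1 (@lebesgue_measure R) m) measurable_rV_cons.

Let step0 : lebesgue_rV_step set0 = 0%E.
Proof. exact: (measure0 step_measure). Qed.

Let step_ge0 A : (0 <= lebesgue_rV_step A)%E.
Proof. exact: (measure_ge0 step_measure). Qed.

Let step_sigma_additive : semi_sigma_additive lebesgue_rV_step.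
Proof. exact: (@measure_semi_sigma_additive _ _ _ step_measure). Qed.

HB.instance Definition _ := isMeasure.Build _ _ _ lebesgue_rV_step
  step0 step_ge0 step_sigma_additive.

Lemma lebesgue_rV_step_sigma_finite : sigma_finite setT lebesgue_rV_step.
Proof.
have /sigma_finiteP[F [FT ndF Foo]] := sigma_finiteT (@lebesgue_measure R).
have /sigma_finiteP[G [GT ndG Goo]] := sigma_finiteT m.
exists (fun k => rV_uncons @^-1` (F k `*` G k)).
  rewrite -preimage_bigcup; apply/esym/seteqP; split=> // x _.
  have [i _ Fi] : (\bigcup_k F k) (rV_uncons x).1 by rewrite -FT.
  have [j _ Gj] : (\bigcup_k G k) (rV_uncons x).2 by rewrite -GT.
  exists (maxn i j) => //; split.
  - by move: Fi; exact/subsetPset/ndF/leq_maxl.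
  - by move: Gj; exact/subsetPset/ndG/leq_maxr.
move=> k; have [mF Fk] := Foo k; have [mG Gk] := Goo k; split.
  rewrite -[X in measurable X]setTI; apply: measurable_rV_uncons => //.
  exact: measurableX.
rewrite /lebesgue_rV_step /pushforward -comp_preimage.
rewrite (_ : rV_uncons \o rV_cons = id).
  by rewrite preimage_id product_measure1E// lte_mul_pinfty// ge0_fin_numE.
by apply/funext => p /=; rewrite rV_consK.
Qed.

HB.instance Definition _ := Measure_isSigmaFinite.Build _ _ _ lebesgue_rV_step
  lebesgue_rV_step_sigma_finite.

End lebesgue_rV_step.

(* Lebesgue measure on R^n, as the n-fold product of the Lebesgue measure on R;
   see [lebesgue_rV_box]. *)
Fixpoint lebesgue_rV (R : realType) (n : nat) :
    {sigma_finite_measure set 'rV[R]_n -> \bar R} :=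
  match n with
  | 0 => (\d_(0 : 'rV[R]_0) : {finite_measure set _ -> \bar R})
  | k.+1 => lebesgue_rV_step (lebesgue_rV R k)
  end.

Lemma lebesgue_rV_box (R : realType) (n : nat)
    (A : 'I_n -> set (measurableTypeR R)) :
  (forall i, measurable (A i)) ->
  lebesgue_rV R n [set x | forall i, A i (x 0 i)] =
  (\prod_(i < n) lebesgue_measure (A i))%E.
Proof.
elim: n A => [|n IH] A mA.
  rewrite big_ord0 /= diracE mem_set //.
  by case.
pose B : set 'rV[R]_n := [set x | forall i : 'I_n, A (lift ord0 i) (x 0 i)].
have mB : measurable B.
  rewrite (_ : B = \bigcap_(i in [set: 'I_n])
      ((fun x : 'rV[R]_n => x 0 i) @^-1` A (lift ord0 i))).
    apply: fin_bigcap_measurable => // i _; rewrite -[X in measurable X]setTI.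
    exact: measurable_coord (mA _).
  by apply/seteqP; split=> x /= H i; [move=> _; exact: H|exact: H].
rewrite big_ord_recl /= /lebesgue_rV_step /pushforward.
rewrite (_ : _ @^-1` _ = A ord0 `*` B).
  by rewrite product_measure1E// -(IH (fun i => A (lift ord0 i))).
apply/seteqP; split=> [[a v] /= H|[a v] /= [H0 H] i].
  split; first by have := H ord0; rewrite mxE unlift_none.
  by move=> i; have := H (lift ord0 i); rewrite mxE liftK.
by case: (unliftP ord0 i) => [j|] ->; rewrite mxE ?liftK ?unlift_none//; exact: H.
Qed.

Section Euclidean.
Context {R : realType} {n : nat}.
Implicit Types (x y : 'rV[R]_n) (A B : set 'rV[R]_n).

(* Needed because the library norm on row vectors is the sup norm. *)
Definition enorm x : R := Num.sqrt (\sum_i x 0 i ^+ 2).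

Definition eball x (r : R) : set 'rV[R]_n := [set y | enorm (y - x) < r].

Definition set_dist A B : R := inf [set enorm (z.1 - z.2) | z in A `*` B].

End Euclidean.

Section domains.
Context {R : realType} {n : nat}.

Definition bounded_domain (Omega : set 'rV[R]_n) : Prop :=
  [/\ Omega !=set0, open Omega, connected Omega & bounded_set Omega].

(* Near each boundary point, in the coordinates given by an orthogonal matrix Q
   and a distinguished axis i, Omega is the strict epigraph of a Lipschitz
   function g of the other n - 1 coordinates. *)
Definition lipschitz_boundary (Omega : set 'rV[R]_n) : Prop :=
  forall p, (closure Omega `\` Omega) p ->
  exists (Q : 'M[R]_n) (i : 'I_n) (g : 'rV[R]_n.-1 -> R) (r : R),
    [/\ Q *m Q^T = 1%:M, lipschitz g, 0 < r &
      forall x, eball p r x ->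
        Omega x <-> g (col' i (x *m Q)) < (x *m Q) 0 i].

End domains.

Section function_spaces.
Context {R : realType} {n : nat}.
Local Notation leb := (lebesgue_rV R n).
Implicit Types (Omega : set 'rV[R]_n) (u v f : 'rV[R]_n -> R) (s : R).

Definition partial (i : 'I_n) f : 'rV[R]_n -> R :=
  fun x => 'D_(delta_mx 0 i) f x.

(* C^infinity: every iterated partial derivative exists and is continuous. *)
Definition smooth f : Prop := forall l : seq 'I_n,
  continuous (foldr partial f l) /\
  forall i x, derivable (foldr partial f l) x (delta_mx 0 i).

Definition test_function Omega f : Prop :=
  let K := closure [set x | f x != 0] in
  [/\ smooth f, compact K & K `<=` Omega].

(* [f \_ Omega] is the extension of f by zero outside Omega. *)
Definition in_L2 Omega f : Prop := f \_ Omega \in Lfun leb 2%:E.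

Definition L2_norm Omega f : R := fine ('N[leb]_2%:E[EFin \o (f \_ Omega)])%E.

(* Squared Gagliardo seminorm; the integrand vanishes on the diagonal since
   0 / 0 = 0. *)
Definition gagliardo s u : \bar R :=
  (\int[leb]_x \int[leb]_y
    (`|u x - u y| ^+ 2 / enorm (x - y) `^ (n%:R + 2 * s))%:E)%E.

Definition in_Hs s u : Prop :=
  u \in Lfun leb 2%:E /\ (gagliardo s u < +oo)%E.

Definition Hs_norm s u : \bar R :=
  (('N[leb]_2%:E[EFin \o u] ^+ 2 + gagliardo s u) `^ 2^-1)%E.

(* Closure in H^s(R^n) of the test functions on Omega. *)
Definition in_tHs s Omega u : Prop :=
  in_Hs s u /\
  forall e : R, 0 < e ->
    exists2 phi, test_function Omega phi & (Hs_norm s (u \- phi)%R < e%:E)%E.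

Definition tHs_norm s u : R := Num.sqrt (fine (gagliardo s u)).

End function_spaces.

Section coupled_form.
Context {R : realType} {n : nat}.
Local Notation leb := (lebesgue_rV R n).
Local Notation fct := ('rV[R]_n -> R).

Definition Gamma (x : R) : R :=
  \int[lebesgue_measure]_(t in `]0, +oo[) (t `^ (x - 1) * expR (- t)).

(* c(n, s) = 2^(2s) s Gamma(s + n/2) / (pi^(n/2) Gamma(1 - s)), the constant for
   which c(n, s) PV int (u(x) - u(y)) / |x - y|^(n + 2s) dy is the operator of
   Fourier symbol |xi|^(2s). *)
Definition frac_lap_const (s : R) : R :=
  2 `^ (2 * s) * s * Gamma (s + n%:R / 2) /
  (pi `^ (n%:R / 2) * Gamma (1 - s)).

(* Support of a class modulo equality a.e.: the complement of the largest open
   set on which J vanishes a.e. *)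
Definition ess_support (J : fct) : set 'rV[R]_n :=
  [set z | forall U, open U -> U z ->
    ~ leb.-negligible (U `&` [set x | J x != 0])].

Definition dint (A B : set 'rV[R]_n) (F : 'rV[R]_n -> fct) : R :=
  fine (\int[leb]_(x in A) \int[leb]_(y in B) (F x y)%:E)%E.

Definition nonlocal_form (s : R) (A : set 'rV[R]_n) (u v : fct) : R :=
  dint A A (fun x y => (u x - u y) * (v x - v y) /
                       enorm (x - y) `^ (n%:R + 2 * s)).

Variables (s1 s2 : R) (Omega1 Omega2 : set 'rV[R]_n) (J : fct).

(* An element u_1 + u_2 of the direct sum is encoded as the pair (u_1, u_2). *)
Definition in_H (u : fct * fct) : Prop :=
  in_tHs s1 Omega1 u.1 /\ in_tHs s2 Omega2 u.2.

Definition form_A (u v : fct * fct) : R :=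
  frac_lap_const s1 / 2 * nonlocal_form s1 (~` Omega2) u.1 v.1
  + frac_lap_const s2 / 2 * nonlocal_form s2 (~` Omega1) u.2 v.2
  + dint Omega1 Omega2 (fun x y => J (x - y) * (u.1 x - u.2 y) * (v.1 x - v.2 y)).

Definition weak_solution (f1 f2 : fct) (u : fct * fct) : Prop :=
  in_H u /\
  forall v, in_H v ->
    form_A u v = \int[leb]_(x in Omega1) (f1 x * v.1 x)
               + \int[leb]_(x in Omega2) (f2 x * v.2 x).

End coupled_form.

(* Main.v *)
Require Import Defs.
From mathcomp Require Import all_boot all_order all_algebra.
From mathcomp Require Import all_classical all_reals all_analysis.
From mathcomp Require Import measurable_realfun lra ring.
Set Implicit Arguments.
Unset Strict Implicit.
Unset Printing Implicit Defensive.
Import Order.TTheory GRing.Theory Num.Theory.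
Import numFieldNormedType.Exports.
Local Open Scope classical_set_scope.
Local Open Scope ring_scope.

(** The form is coercive on H already through its two Gagliardo parts, and the
bound follows by testing the equation with the solution itself.

With v = u the coupling term is an integral of J(x - y) (u_1(x) - u_2(y))^2,
which is nonnegative ([coupling_ge0]), so

  C_1 E_1 + C_2 E_2 <= |f_1| |u_1|_{L^2} + |f_2| |u_2|_{L^2},

where E_i is the double integral of the Gagliardo integrand of u_i over the
square B^c x B^c of the complement of the other domain B.  The L^2 norm and the
full seminorm of u_i are both bounded by a multiple of the square root of E_i
([nonlocal_form_coercive]), so the right side is linear in a quantity of which
the left side controls the square ([quadratic_absorption]).  The two bounds on
one component use that u_i vanishes a.e. outside Omega_i ([tHs_ae0]).

- Poincare ([energy_poincare]): B^c contains a unit cube S away from Omega_i.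
  For x in Omega_i and y in S the numerator is u_i(x)^2 and the kernel is
  bounded below, so integrating over Omega_i x S gives a multiple of the squared
  L^2 norm as a lower bound for E_i.
- Localization ([energy_localize]): the squared seminorm exceeds E_i only by the
  pairs with a point in B.  There the numerator is the square of the value of
  u_i at the other point, which matters only in Omega_i, and the kernel is
  bounded because the two domains have disjoint compact closures; as B has
  finite measure, the excess is at most a multiple of the squared L^2 norm,
  hence of E_i.

The constants C_i are positive because the Gamma integral converges and is
positive on the positive half-line ([Gamma_gt0]), and the nonnegativity of the
coupling uses that y |-> x - y preserves Lebesgue measure on R^n
([lebesgue_rV_reflect]), which turns the a.e. sign of J into an a.e. statement
in y for every fixed x. *)

(** * Borel sets, Euclidean norm and Lebesgue measure on R^n *)

Lemma measurable_row_box {R : realType} {n : nat}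
    (A : 'I_n -> set (measurableTypeR R)) :
  (forall i, measurable (A i)) ->
  measurable [set x : 'rV[R]_n | forall i, A i (x 0 i)].
Proof.
move=> mA.
rewrite (_ : mkset _ = \bigcap_(i in [set: 'I_n])
    ((fun x : 'rV[R]_n => x 0 i) @^-1` A i)).
  apply: fin_bigcap_measurable => // i _; rewrite -[X in measurable X]setTI.
  exact: measurable_coord (mA _).
by apply/seteqP; split=> x /= H i; [move=> _; exact: H|exact: H].
Qed.

(** The sigma-algebra is generated by coordinates, so an open set is written as
the countable union of the rational boxes that it contains. *)
Lemma open_measurable_rV {R : realType} {n : nat} (U : set 'rV[R]_n) :
  open U -> measurable U.
Proof.
move=> oU.
pose box (p : {ffun 'I_n -> rat} * nat) : set 'rV[R]_n :=
  [set x | forall i : 'I_n,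
    `]ratr (p.1 i) - p.2.+1%:R^-1, ratr (p.1 i) + p.2.+1%:R^-1[%classic (x 0 i)].
have -> : U = \bigcup_p (if asbool (box p `<=` U) then box p else set0).
  apply/seteqP; split => [x Ux|x [p _]]; last first.
    by case: ifPn => // /asboolP; exact.
  have /nbhs_ballP[e /= e0 xeU] := open_nbhs_nbhs (conj oU Ux).
  (* any point of a box of half-width 1/(k+1) around a rational point within
     1/(k+1) of x is within 2/(k+1) of x *)
  have [k ke] : exists k, 2 * k.+1%:R^-1 < e.
    have /ltr_add_invr[k] : 0 < e / 2 by rewrite divr_gt0.
    by rewrite add0r => ke; exists k; rewrite mulrC -ltr_pdivlMr.
  have k0 : (0 : R) < k.+1%:R^-1 by rewrite invr_gt0.
  have /choice[q qP] : forall i : 'I_n, exists r : rat,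
      x 0 i - k.+1%:R^-1 < ratr r < x 0 i + k.+1%:R^-1.
    move=> i; have /rat_in_itvoo[r] :
        x 0 i - k.+1%:R^-1 < x 0 i + k.+1%:R^-1.
      by rewrite ltrBlDr -addrA ltrDl addr_gt0.
    by rewrite in_itv /= => rP; exists r.
  exists ([ffun i => q i], k) => //; rewrite ifT.
    move=> i /=; rewrite in_itv /= ffunE.
    have /andP[? ?] := qP i; apply/andP; split; first by rewrite ltrBlDr.
    by rewrite -ltrBlDr.
  apply/asboolP => y yb; apply: xeU; split=> // i j.
  rewrite (ord1 i); have := yb j; rewrite /= in_itv /= ffunE.
  have := qP j; move: ke; rewrite /ball /=.
  move: (x 0 j) (y 0 j) (ratr (q j) : R) (k.+1%:R^-1 : R) => a b r s ? /andP[? ?] /andP[? ?].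
  by rewrite ltr_norml; apply/andP; split; lra.
apply: countable_bigcupT_measurable; first exact: countableP.
move=> p; case: ifP => // _.
have /= := @measurable_row_box R n
  (fun i => `]ratr (p.1 i) - p.2.+1%:R^-1, ratr (p.1 i) + p.2.+1%:R^-1[%classic).
by apply => i; exact: measurable_itv.
Qed.

Lemma continuous_measurable_rV {R : realType} {n : nat} (f : 'rV[R]_n -> R) :
  continuous f -> measurable_fun setT f.
Proof.
move=> cf; apply: (measurability _ (RGenOpens.measurableE R)).
move=> _ [_ [a [b ->] <-]]; rewrite setTI; apply: open_measurable_rV.
by apply: open_comp; [move=> x _; exact: cf|exact: interval_open].
Qed.

Lemma measurable_enorm {R : realType} {n : nat} d (T : measurableType d)
    (f : T -> 'rV[R]_n) :
  measurable_fun setT f -> measurable_fun setT (fun t => enorm (f t)).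
Proof.
move=> mf; apply: (@measurableT_comp _ _ _ _ _ _ (@Num.sqrt R)).
  by apply: continuous_measurable_fun; exact: sqrt_continuous.
apply: measurable_sum => i; apply: measurable_funX.
by apply: (measurableT_comp (measurable_coord i)).
Qed.

Lemma measurable_fun_subrV {R : realType} {n : nat} d (T : measurableType d)
    (f g : T -> 'rV[R]_n) :
  measurable_fun setT f -> measurable_fun setT g ->
  measurable_fun setT (fun t => f t - g t).
Proof.
move=> mf mg; apply: measurable_fun_coordP => i.
rewrite (_ : (fun t => _) = (fun t => f t 0 i - g t 0 i)).
  by apply: measurable_funB; exact: (measurableT_comp (measurable_coord i)).
by apply/funext => t; rewrite !mxE.
Qed.

Lemma enorm_ge_coord {R : realType} {n : nat} (x : 'rV[R]_n) i :
  `|x 0 i| <= enorm x.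
Proof.
rewrite -sqrtr_sqr; apply: ler_wsqrtr.
by rewrite (bigD1 i) //= lerDl; apply: sumr_ge0 => j _; exact: sqr_ge0.
Qed.

Lemma enorm_le_coord {R : realType} {n : nat} (x : 'rV[R]_n) (b : R) :
  0 <= b -> (forall i, `|x 0 i| <= b) -> enorm x <= Num.sqrt n%:R * b.
Proof.
move=> b0 xb; rewrite -[b in leRHS]ger0_norm// -sqrtr_sqr -sqrtrM ?ler0n//.
apply: ler_wsqrtr.
rewrite mulr_natl -[n in leRHS]card_ord -sumr_const; apply: ler_sum => i _.
by rewrite -[x 0 i ^+ 2]real_normK ?num_real// lerXn2r// nnegrE.
Qed.

Lemma lebesgue_measure_reflect {R : realType} (c : R)
    (A : set (measurableTypeR R)) : measurable A ->
  lebesgue_measure ((fun t => c - t) @^-1` A) = lebesgue_measure A.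
Proof.
move=> mA.
have mphi : measurable_fun setT (fun t : measurableTypeR R => c - t : measurableTypeR R).
  exact: measurable_funB.
apply/esym/(@lebesgue_measure_unique R
  (measure_function_pushforward__canonical__measure_function_Measure
    (@lebesgue_measure R) mphi)) => // _ [[a b] /= _ <-].
rewrite /pushforward (_ : _ @^-1` _ = `[c - b, c - a[%classic).
  rewrite !lebesgue_measure_itv /= !lte_fin ltrD2l ltrN2.
  by case: ifP => // _; rewrite -!EFinD; congr EFin; ring.
by apply/seteqP; split => t /=; rewrite !in_itv /= => /andP[? ?];
  apply/andP; split; lra.
Qed.

(** By uniqueness of product measures, the reflection being a product of
one-dimensional reflections under the splitting R x R^n of R^(n+1). *)
Lemma lebesgue_rV_reflect {R : realType} {n : nat} (c : 'rV[R]_n)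
    (A : set 'rV[R]_n) : measurable A ->
  lebesgue_rV R n ((fun y => c - y) @^-1` A) = lebesgue_rV R n A.
Proof.
elim: n c A => [|n IH] c A mA.
  by congr (lebesgue_rV R 0 _); apply/seteqP; split => y /=;
    rewrite (_ : c - y = y)//; apply/rowP => -[].
rewrite /= /lebesgue_rV_step /pushforward.
pose phi (p : measurableTypeR R * 'rV[R]_n) : measurableTypeR R * 'rV[R]_n :=
  ((rV_uncons c).1 - p.1, (rV_uncons c).2 - p.2).
have mphi : measurable_fun setT phi.
  apply: measurable_fun_pair.
    rewrite (_ : (fun _ => _) = (fun t => (rV_uncons c).1 - t) \o fst) //.
    by apply: measurableT_comp => //; exact: measurable_funB.
  exact: measurable_fun_subrV.
have consB p : c - rV_cons p = rV_cons (phi p).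
  apply/rowP => i; rewrite !mxE.
  by case: (unliftP 0 i) => [j|] ->; rewrite /= ?mxE.
rewrite (_ : _ @^-1` _ = phi @^-1` (rV_cons @^-1` A)); last first.
  by apply/seteqP; split => p /=; rewrite consB.
have mB : measurable (@rV_cons R n @^-1` A).
  by rewrite -[X in measurable X]setTI; exact: measurable_rV_cons.
apply/esym/(@product_measure_unique _ _ _ _ _ (@lebesgue_measure R) (lebesgue_rV R n)
  (measure_function_pushforward__canonical__measure_function_Measure
    (product_measure1 (@lebesgue_measure R) (lebesgue_rV R n)) mphi)) => // B C mB' mC.
rewrite /= /pushforward.
rewrite (_ : _ @^-1` _ = ((fun t => (rV_uncons c).1 - t) @^-1` B) `*`
   ((fun t => (rV_uncons c).2 - t) @^-1` C)); last by [].
rewrite product_measure1E//.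
- by congr (_ * _)%E; [exact: lebesgue_measure_reflect|exact: IH].
- rewrite -[X in measurable X]setTI.
  have : measurable_fun setT (fun t : measurableTypeR R => (rV_uncons c).1 - t : measurableTypeR R).
    exact: measurable_funB.
  exact.
- rewrite -[X in measurable X]setTI.
  have : measurable_fun setT (fun t : 'rV[R]_n => (rV_uncons c).2 - t).
    exact: measurable_fun_subrV.
  exact.
Qed.

Lemma ae_reflect {R : realType} {n : nat} (c : 'rV[R]_n) (P : 'rV[R]_n -> Prop) :
  {ae lebesgue_rV R n, forall z, P z} ->
  {ae lebesgue_rV R n, forall y, P (c - y)}.
Proof.
move=> [N [mN N0 PN]]; exists ((fun y => c - y) @^-1` N); split.
- rewrite -[X in measurable X]setTI.
  have : measurable_fun setT (fun t : 'rV[R]_n => c - t).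
    exact: measurable_fun_subrV.
  exact.
- by rewrite lebesgue_rV_reflect.
- by move=> y /= nP; exact: PN.
Qed.

(** * Weighted energies of functions supported in a set *)

Lemma measurable_inner_integral {R : realType} d1 d2 (T1 : measurableType d1)
    (T2 : measurableType d2) (m2 : {sigma_finite_measure set T2 -> \bar R})
    (k : T1 -> T2 -> \bar R) (B : set T2) :
  measurable B -> (forall x y, (0 <= k x y)%E) ->
  measurable_fun setT (fun z : T1 * T2 => k z.1 z.2) ->
  measurable_fun setT (fun x => \int[m2]_(y in B) k x y)%E.
Proof.
move=> mB k0 mk.
pose kB : T1 * T2 -> \bar R := (fun z => k z.1 z.2) \_ (setT `*` B).
have mkB : measurable_fun setT kB.
  apply/(measurable_restrictT _ _).1; first exact: measurableX.
  exact: measurable_funTS.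
rewrite (_ : (fun x => _) = fubini_F m2 kB).
  apply: measurable_fun_fubini_tonelli_F => // z.
  by rewrite /kB patchE; case: ifP.
apply/funext => x; rewrite integral_mkcond; apply: eq_integral => y _.
by rewrite /kB !patchE in_setX in_setT.
Qed.

Section energy.
Context {R : realType} d (T : measurableType d).
Variable mu : {sigma_finite_measure set T -> \bar R}.
Variables (u : T -> R) (w : T -> T -> R).

(** The weight [w] is kept abstract because the estimates below see it only
through pointwise bounds on products of sets. *)
Definition energy (A B : set T) : \bar R :=
  (\int[mu]_(x in A) \int[mu]_(y in B) ((u x - u y) ^+ 2 * w x y)%:E)%E.

Hypothesis meas_u : measurable_fun setT u.
Hypothesis w0 : forall x y, 0 <= w x y.
Hypothesis mw : measurable_fun setT (fun z : T * T => w z.1 z.2).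

Let k0 x y : (0 <= ((u x - u y) ^+ 2 * w x y)%:E)%E.
Proof. by rewrite lee_fin mulr_ge0// sqr_ge0. Qed.

Let mk : measurable_fun setT
  (fun z : T * T => ((u z.1 - u z.2) ^+ 2 * w z.1 z.2)%:E).
Proof.
apply/measurable_EFinP; apply: measurable_funM => //; apply: measurable_funX.
by apply: measurable_funB; exact: measurableT_comp.
Qed.

Let mkx x : measurable_fun setT (fun y => ((u x - u y) ^+ 2 * w x y)%:E).
Proof. exact: (measurableT_comp mk (measurable_pair1 x)). Qed.

Let mI B : measurable B ->
  measurable_fun setT (fun x => \int[mu]_(y in B) ((u x - u y) ^+ 2 * w x y)%:E)%E.
Proof.
by move=> mB; apply: (@measurable_inner_integral _ _ _ _ _ mu
  (fun x y => ((u x - u y) ^+ 2 * w x y)%:E)).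
Qed.

Lemma le_energy A : measurable A -> (energy A A <= energy setT setT)%E.
Proof.
move=> mA; apply: (@le_trans _ _ (energy A setT)); last first.
  apply: ge0_subset_integral => //; first exact: mI.
  by move=> x _; exact: integral_ge0.
apply: ge0_le_integral => //.
- by move=> x _; exact: integral_ge0.
- by apply: measurable_funTS; exact: mI.
- by apply: measurable_funTS; exact: mI.
by move=> x _; exact: ge0_subset_integral.
Qed.

Let meas_u2 : measurable_fun setT (fun x => (u x ^+ 2)%:E).
Proof. by apply/measurable_EFinP; exact: measurable_funX. Qed.

Let u20 x : (0 <= (u x ^+ 2)%:E)%E.
Proof. by rewrite lee_fin sqr_ge0. Qed.

Variable O : set T.
Hypothesis mO : measurable O.
Hypothesis uO : {ae mu, forall x, ~ O x -> u x = 0}.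

Lemma integral_sqr_supported :
  (\int[mu]_x (u x ^+ 2)%:E = \int[mu]_(x in O) (u x ^+ 2)%:E)%E.
Proof.
rewrite [RHS]integral_mkcond; apply: ge0_ae_eq_integral => //.
- by apply/(measurable_restrictT _ _).1 => //; exact: measurable_funTS.
- by move=> x _; rewrite patchE; case: ifP.
apply: filterS uO => x ux _; rewrite patchE; case: ifPn => //.
by rewrite notin_setE => /ux ->; rewrite expr0n.
Qed.

(** Only the pairs (x, y) in O x S are kept: there u(y) = 0 for a.e. y, and the
integrand is at least m u(x)^2. *)
Lemma energy_poincare (A S : set T) (m : R) :
  measurable A -> measurable S -> O `<=` A -> S `<=` A -> O `&` S = set0 ->
  0 <= m -> (forall x y, O x -> S y -> m <= w x y) ->
  (m%:E * mu S * \int[mu]_x (u x ^+ 2)%:E <= energy A A)%E.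
Proof.
move=> mA mS OA SA OS m0 mw_.
have mS0 : (0 <= m%:E * mu S)%E by rewrite mule_ge0.
rewrite integral_sqr_supported -ge0_integralZl//; last exact: measurable_funTS.
apply: (@le_trans _ _ (energy O A)); last first.
  apply: ge0_subset_integral => //; first by apply: measurable_funTS; exact: mI.
  by move=> x _; exact: integral_ge0.
apply: ge0_le_integral => //.
- by move=> x _; rewrite mule_ge0.
- by apply: emeasurable_funM => //; exact: measurable_funTS.
- by apply: measurable_funTS; exact: mI.
move=> x Ox.
apply: (@le_trans _ _ (\int[mu]_(y in S) ((u x - u y) ^+ 2 * w x y)%:E)%E); last first.
  by apply: ge0_subset_integral => //; apply: measurable_funTS; exact: mkx.
rewrite (_ : (_ * _)%E = \int[mu]_(y in S) (u x ^+ 2 * m)%:E)%E; last first.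
  by rewrite integral_cst// EFinM muleC muleA.
apply: ae_ge0_le_integral => //.
- by move=> y _; rewrite lee_fin mulr_ge0// sqr_ge0.
- by apply: measurable_funTS; exact: mkx.
apply: filterS uO => y uy Sy; rewrite uy ?subr0; last first.
  by move=> Oy; have : (O `&` S) y by []; rewrite OS.
by rewrite lee_fin ler_wpM2l ?sqr_ge0 ?mw_.
Qed.

(** The pairs with a point in B split into (~B) x B and B x T.  In both, one of
the two values of u vanishes a.e., and the other is supported in O, where the
weight is at most M.  Bounding B x T as a whole avoids a separate treatment of
B x B, on which the integrand vanishes a.e. *)
Lemma energy_localize (B : set T) (M : R) :
  measurable B -> O `&` B = set0 -> 0 <= M ->
  (forall x y, O x -> B y -> w x y <= M /\ w y x <= M) ->
  (energy setT setT <= energy (~` B) (~` B) +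
     (2 * M)%:E * mu B * \int[mu]_x (u x ^+ 2)%:E)%E.
Proof.
move=> mB OB M0 wM.
have mC : measurable (~` B) by exact: measurableC.
have dis : [disjoint ~` B & B] by apply/eqP; rewrite setICl.
have Tsplit : setT = ~` B `|` B by rewrite setUC setUv.
have split_outer F : measurable_fun setT F -> (forall x, 0 <= F x)%E ->
    (\int[mu]_x F x = \int[mu]_(x in ~` B) F x + \int[mu]_(x in B) F x)%E.
  by move=> mF F0; rewrite Tsplit ge0_integral_setU// -Tsplit.
have mN0 : (0 <= M%:E * mu B)%E by rewrite mule_ge0.
have crossL : (energy (~` B) B <= M%:E * mu B * \int[mu]_x (u x ^+ 2)%:E)%E.
  apply: (@le_trans _ _ (\int[mu]_(x in ~` B) (M%:E * mu B * (u x ^+ 2)%:E))%E).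
    apply: ae_ge0_le_integral => //.
    - by move=> x _; exact: integral_ge0.
    - by apply: measurable_funTS; exact: mI.
    - by move=> x _; rewrite mule_ge0.
    - by apply: emeasurable_funM => //; exact: measurable_funTS.
    apply: filterS uO => x ux _.
    rewrite (_ : (_ * _)%E = \int[mu]_(y in B) (u x ^+ 2 * M)%:E)%E; last first.
      by rewrite integral_cst// EFinM muleC muleA.
    apply: ae_ge0_le_integral => //.
    - by apply: measurable_funTS; exact: mkx.
    - by move=> y _; rewrite lee_fin mulr_ge0// sqr_ge0.
    apply: filterS uO => y uy By; rewrite uy ?subr0; last first.
      by move=> Oy; have : (O `&` B) y by []; rewrite OB.
    have [Ox|/ux ->] := pselect (O x); last by rewrite expr0n !mul0r.
    by rewrite lee_fin ler_wpM2l ?sqr_ge0//; have [] := wM x y Ox By.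
  rewrite ge0_integralZl//; last exact: measurable_funTS.
  by apply: lee_wpmul2l => //; exact: ge0_subset_integral.
have crossR : (energy B setT <= M%:E * mu B * \int[mu]_x (u x ^+ 2)%:E)%E.
  apply: (@le_trans _ _ (\int[mu]_(x in B) (M%:E * \int[mu]_x (u x ^+ 2)%:E))%E); last first.
    by rewrite integral_cst// muleAC.
  apply: ae_ge0_le_integral => //.
  - by move=> x _; exact: integral_ge0.
  - by apply: measurable_funTS; exact: mI.
  - by move=> x _; rewrite mule_ge0// integral_ge0.
  apply: filterS uO => x ux Bx.
  rewrite -ge0_integralZl//.
  apply: ae_ge0_le_integral => //.
  - by move=> y _; rewrite mule_ge0.
  - by apply: emeasurable_funM.
  apply: filterS uO => y uy _.
  rewrite ux ?sub0r ?sqrrN; last first.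
    by move=> Ox; have : (O `&` B) x by []; rewrite OB.
  have [Oy|/uy ->] := pselect (O y); last by rewrite expr0n mul0r mule0.
  by rewrite -EFinM lee_fin mulrC ler_wpM2r ?sqr_ge0//; have [] := wM y x Oy Bx.
rewrite /energy split_outer//; last 2 first.
- exact: mI.
- by move=> x; exact: integral_ge0.
have -> : (\int[mu]_(x in ~` B) \int[mu]_y ((u x - u y) ^+ 2 * w x y)%:E =
    energy (~` B) (~` B) + energy (~` B) B)%E.
  rewrite /energy -ge0_integralD//.
  - apply: eq_integral => x _; apply: split_outer => //; exact: mkx.
  - by move=> x _; exact: integral_ge0.
  - by apply: measurable_funTS; exact: mI.
  - by move=> x _; exact: integral_ge0.
  - by apply: measurable_funTS; exact: mI.
rewrite -addeA leeD2l//; apply: le_trans (leeD crossL crossR) _.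
by rewrite mulr_natl mulr2n EFinD !ge0_muleDl ?lee_fin ?mule_ge0 ?lee_fin.
Qed.

End energy.

(** * Positivity of the Gamma function and of the normalization constant *)

Section Gamma_positive.
Context {R : realType}.
Local Notation mu := (@lebesgue_measure R).

Let gam (x t : R) : R := t `^ (x - 1) * expR (- t).

Let gam_ge0 x t : 0 <= gam x t.
Proof. by rewrite mulr_ge0 ?powR_ge0 ?expR_ge0. Qed.

Let measurable_gam x : measurable_fun setT (gam x).
Proof.
apply: measurable_funM; first exact: measurable_powR.
by apply: measurableT_comp => //; exact: measurable_funN.
Qed.

(** The singularity at 0 is approached by the intervals [1/(k+2), 1], on which
t^x / x is an antiderivative and the integral is at most 1/x. *)
Lemma integral_powR_01_lty (x : R) : 0 < x ->
  (\int[mu]_(t in `]0%R, 1%R]) (t `^ (x - 1))%:E < +oo)%E.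
Proof.
move=> x0.
pose F (k : nat) : set R := `[k.+2%:R^-1, 1]%classic.
have k2 (k : nat) : (0 : R) < k.+2%:R^-1 by rewrite invr_gt0.
have UF : `]0, 1]%classic = \bigcup_k F k :> set R.
  apply/seteqP; split => [t|t [k _]]; rewrite /F /= !in_itv /=.
    move=> /andP[t0 t1]; have /ltr_add_invr[k] := t0.
    rewrite add0r => kt; exists k => //=; rewrite in_itv /= t1 andbT.
    by rewrite (le_trans _ (ltW kt))// lef_pV2 ?posrE// ler_nat.
  by move=> /andP[kt t1]; rewrite t1 andbT (lt_le_trans (k2 k)).
have mF k : measurable (F k) by exact: measurable_itv.
have mp : measurable_fun setT (fun t : R => (t `^ (x - 1))%:E).
  by apply/measurable_EFinP; exact: measurable_powR.
have ndF : nondecreasing_seq F.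
  move=> k l kl; apply/subsetPset => t; rewrite /F /= !in_itv /= => /andP[kt ->].
  by rewrite andbT (le_trans _ kt)// lef_pV2 ?posrE// ler_nat !ltnS.
have := @ge0_nondecreasing_set_cvg_integral _ (measurableTypeR R) R F
  (fun t => (t `^ (x - 1))%:E) (@lebesgue_measure R) ndF mF
  (fun i => measurable_funS measurableT (@subsetT _ _) mp)
  (fun i t _ => powR_ge0 t (x - 1)).
rewrite -UF => cv; apply: (@le_lt_trans _ _ (x^-1)%:E); last exact: ltry.
rewrite -(cvg_lim _ cv)//; apply: lime_le; first by apply/cvg_ex; eexists; exact: cv.
apply: nearW => k.
have cont1 (y : R) (t : R) : 0 < t -> {for t, continuous (fun s : R => s `^ y)}.
  move=> t0; apply: differentiable_continuous; apply/derivable1_diffP.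
  by apply: derivable_powR; rewrite in_itv /= t0.
rewrite (@continuous_FTC2 _ _ (fun t => x^-1 * t `^ x)).
- by rewrite powR1 mulr1 -EFinB lee_fin gerBl mulr_ge0 ?powR_ge0 ?invr_ge0 ?ltW.
- by rewrite invf_lt1// ltr1n.
- apply: continuous_in_subspaceT => t; rewrite inE /= in_itv /= => /andP[kt _].
  by apply: cont1; exact: lt_le_trans kt.
- split.
  + move=> t; rewrite in_itv /= => /andP[kt _].
    apply: derivableM => //; apply: derivable_powR.
    by rewrite in_itv /= andbT (lt_trans (k2 k)).
  + apply: cvg_at_right_filter; apply: cvgM; first exact: cvg_cst.
    exact: cont1.
  + apply: cvg_at_left_filter; apply: cvgM; first exact: cvg_cst.
    exact: cont1.
- move=> t; rewrite in_itv /= => /andP[kt _].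
  have t0 := lt_trans (k2 k) kt.
  rewrite derive1E deriveZ /=; last by apply: derivable_powR; rewrite in_itv /= t0.
  rewrite -derive1E powR_derive1 ?in_itv /= ?t0//.
  by rewrite /GRing.scale /= mulrA mulVf ?mul1r// gt_eqF.
Qed.

(** The bound is (x - 1) ln t <= t/2 + const; it comes from ln (t/c) < t/c with
c = 2 |x - 1| + 1, the choice that makes |x - 1| / c at most 1/2. *)
Lemma gamma_integrand_tail (x t : R) : 1 <= t ->
  gam x t <= expR (`|x - 1| * ln (2 * `|x - 1| + 1)) * expR (- t / 2).
Proof.
move=> t1; have t0 : 0 < t by exact: lt_le_trans t1.
set y := `|x - 1|; have y0 : 0 <= y by exact: normr_ge0.
have c0 : 0 < 2 * y + 1 by lra.
rewrite /gam /powR gt_eqF// -!expRD ler_expR.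
have lnt0 : 0 <= ln t by exact: ln_ge0.
have h1 : (x - 1) * ln t <= y * ln t by rewrite ler_wpM2r// ler_norm.
have h2 : ln t <= t / (2 * y + 1) + ln (2 * y + 1).
  rewrite -lerBlDr -ln_div ?posrE//; apply/ltW/ln_sublinear.
  by rewrite divr_gt0.
have h3 : y * ln t <= y * (t / (2 * y + 1)) + y * ln (2 * y + 1).
  by rewrite -mulrDr ler_wpM2l.
have h4 : y * (t / (2 * y + 1)) <= t / 2.
  rewrite mulrA ler_pdivrMr//.
  have := mulr_ge0 y0 (ltW t0); nra.
lra.
Qed.

(** Convergence matters here: a divergent integral would have real value 0.  Near
0 the power is compared with its own integral, and the tail with the density of
the exponential law of rate 1/2. *)
Lemma Gamma_gt0 (x : R) : 0 < x -> 0 < Gamma x.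
Proof.
move=> x0.
have mg : measurable_fun setT (fun t : R => (gam x t)%:E).
  by apply/measurable_EFinP.
have itvE : `]0, +oo[%classic = `]0, 1]%classic `|` `]1, +oo[%classic :> set R.
  apply/seteqP; split => t; rewrite /= !in_itv /= ?andbT.
    by move=> ->; case: (leP t 1); [left|right].
  by move=> [/andP[]//|]; apply: lt_trans.
have ltoo : (\int[mu]_(t in `]0%R, +oo[) (gam x t)%:E < +oo)%E.
  rewrite itvE ge0_integral_setU//=; first last.
  - apply/eqP/seteqP; split => t //=; rewrite !in_itv /= andbT => -[/andP[_ +]].
    by rewrite leNgt => /negP.
  - by move=> t _; rewrite lee_fin.
  - exact: measurable_funS mg.
  apply: lte_add_pinfty.
    apply: (@le_lt_trans _ _ (\int[mu]_(t in `]0%R, 1%R]) (t `^ (x - 1))%:E)%E);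
      last exact: integral_powR_01_lty.
    apply: ge0_le_integral => //.
    + by move=> t _; rewrite lee_fin.
    + exact: measurable_funS mg.
    + apply: measurable_funTS; apply/measurable_EFinP; exact: measurable_powR.
    + move=> t; rewrite /= in_itv /= => /andP[t0 _]; rewrite lee_fin ler_piMr ?powR_ge0//.
      by rewrite -expR0 ler_expR oppr_le0 ltW.
  pose K := expR (`|x - 1| * ln (2 * `|x - 1| + 1)).
  have me : measurable_fun setT (EFin \o exponential_pdf (2^-1 : R)).
    by apply/measurable_EFinP; exact: measurable_exponential_pdf.
  have e0 t : 0 <= exponential_pdf (2^-1 : R) t.
    by apply: exponential_pdf_ge0; rewrite invr_ge0.
  apply: (@le_lt_trans _ _ (\int[mu]_t ((2 * K)%:E * (exponential_pdf 2^-1 t)%:E)%E)%E).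
    apply: le_trans (@ge0_subset_integral _ _ _ mu `]1, +oo[%classic setT _ _ _ _ _ _) => //.
    + apply: ge0_le_integral => //.
      * by move=> t _; rewrite lee_fin.
      * exact: measurable_funS mg.
      * by apply: measurable_funTS; exact: emeasurable_funM.
      * move=> t; rewrite /= in_itv /= andbT => t1; rewrite -EFinM lee_fin.
        rewrite exponential_pdfE ?(le_trans _ (ltW t1))//.
        rewrite mulrACA divff// mul1r mulNr -mulrN.
        apply: le_trans (gamma_integrand_tail _ (ltW t1)) _.
        by rewrite ler_wpM2l ?expR_ge0// ler_expR; lra.
    + exact: emeasurable_funM.
    + by move=> t _; rewrite -EFinM lee_fin mulr_ge0// mulr_ge0// expR_ge0.
  rewrite ge0_integralZl//; last 2 first.
  - by move=> t _; rewrite lee_fin.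
  - by rewrite lee_fin mulr_ge0// expR_ge0.
  by rewrite integral_exponential_pdf ?invr_gt0// mule1 ltry.
have gt0 : (0 < \int[mu]_(t in `]0%R, +oo[) (gam x t)%:E)%E.
  rewrite lt0e integral_ge0 ?andbT; last by move=> t _; rewrite lee_fin.
  apply/eqP => I0.
  have mg' : measurable_fun (`]0, +oo[%classic : set (measurableTypeR R))
      (fun t : R => (gam x t)%:E).
    exact: measurable_funS mg.
  have [N [mN N0 sN]] : ae_eq mu (`]0, +oo[%classic : set (measurableTypeR R))
      (fun t : R => (gam x t)%:E) (cst 0).
    apply/(ae_eq_integral_abs mu _ mg') => //.
    by rewrite -I0; apply: eq_integral => t _; rewrite gee0_abs// lee_fin.
  have : (mu (`]0%R, 1%R[%classic : set (measurableTypeR R)) <= mu N)%E.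
    apply: le_measure; rewrite ?inE//; apply: subset_trans sN => t /=.
    rewrite in_itv /= => /andP[t0 _] H.
    have : (gam x t)%:E = 0%E by apply: H; rewrite in_itv /= t0.
    by move/eqP; rewrite eqe gt_eqF// mulr_gt0 ?powR_gt0 ?expR_gt0.
  by rewrite N0 lebesgue_measure_itv /= lte_fin ltr01 oppr0 adde0 lee_fin ler10.
rewrite /Gamma /Rintegral fine_gt0//; apply/andP; split => //.
Qed.

Lemma frac_lap_const_gt0 (n : nat) (s : R) : 0 < s < 1 ->
  0 < @frac_lap_const R n s.
Proof.
move=> /andP[s0 s1]; rewrite /frac_lap_const.
rewrite divr_gt0// mulr_gt0 ?powR_gt0 ?pi_gt0 ?Gamma_gt0 ?subr_gt0//.
- by rewrite mulr_gt0 // powR_gt0.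
- by rewrite ltr_pwDl// divr_ge0.
Qed.

End Gamma_positive.

(** * The L^2 norm and the spaces of functions supported in a domain *)

Section L2.
Context d (T : measurableType d) {R : realType}.
Variable mu : {measure set T -> \bar R}.
Implicit Types f g : T -> R.

Lemma Lnorm2_integral f :
  ('N[mu]_2%:E[EFin \o f] = (\int[mu]_x (f x ^+ 2)%:E) `^ 2^-1)%E.
Proof.
rewrite unlock; congr (_ `^ _)%E; apply: eq_integral => x _.
by rewrite /= powR_mulrn ?normr_ge0// real_normK// num_real.
Qed.

Lemma Lnorm2_sqr f :
  ('N[mu]_2%:E[EFin \o f] ^+ 2 = \int[mu]_x (f x ^+ 2)%:E)%E.
Proof.
rewrite Lnorm2_integral expe2.
have : (0 <= \int[mu]_x (f x ^+ 2)%:E)%E.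
  by apply: integral_ge0 => x _; rewrite lee_fin sqr_ge0.
case: (integral _ _ _) => [r| |]//; last by rewrite poweRyr ?invr_eq0.
rewrite lee_fin => r0.
by rewrite poweR_EFin powR12_sqrt// -EFinM -expr2 sqr_sqrtr.
Qed.

Lemma Lfun2_fin_num f : f \in Lfun mu 2%:E ->
  (\int[mu]_x (f x ^+ 2)%:E)%E \is a fin_num.
Proof. by move=> /Lfun2_integrable_sqr; apply: integrable_fin_num. Qed.

Lemma Lfun_measurable f p : f \in Lfun mu p -> measurable_fun setT f.
Proof. by rewrite inE => /andP[]; rewrite inE. Qed.

Lemma Rintegral_cauchy_schwarz (D : set T) f g : measurable D ->
  f \_ D \in Lfun mu 2%:E -> g \in Lfun mu 2%:E ->
  (\int[mu]_(x in D) (f x * g x) <=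
   fine ('N[mu]_2%:E[EFin \o (f \_ D)])%E
     * Num.sqrt (fine (\int[mu]_x (g x ^+ 2)%:E)%E)).
Proof.
move=> mD fL gL.
have fgL := Lfun2_mul_Lfun1 fL gL.
rewrite Rintegral_mkcond.
have -> : (fun x => f x * g x) \_ D = (f \_ D) \* g.
  by apply/funext => x; rewrite /= !patchE; case: ifP => // _; rewrite mul0r.
have ifg : mu.-integrable setT (EFin \o ((f \_ D) \* g)) by exact/Lfun1_integrable.
apply: (le_trans (ler_norm _)); apply: (le_trans (le_normr_Rintegral measurableT ifg)).
have N2 h : h \in Lfun mu 2%:E -> ('N[mu]_2%:E[EFin \o h])%E \is a fin_num.
  by move=> hL; rewrite ge0_fin_numE ?Lnorm_ge0//; move: hL => /[!inE]/andP[_]; rewrite inE.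
have -> : Num.sqrt (fine (\int[mu]_x (g x ^+ 2)%:E)%E)
    = fine ('N[mu]_2%:E[EFin \o g])%E.
  rewrite Lnorm2_integral fine_poweR powR12_sqrt//; apply: fine_ge0.
  by apply: integral_ge0 => x _; rewrite lee_fin sqr_ge0.
rewrite -fineM ?N2// /Rintegral; apply: fine_le.
- exact: (integrable_fin_num measurableT (integrable_norm ifg)).
- by rewrite fin_numM// N2.
have := @hoelder _ _ _ mu _ _ 2 2 (Lfun_measurable fL) (Lfun_measurable gL).
rewrite Lnorm1 => /(_ _ _ _); apply => //.
by rewrite [RHS]splitr !div1r.
Qed.

End L2.

Section tilde_Hs.
Context {R : realType} {n : nat}.
Local Notation leb := (lebesgue_rV R n).
Implicit Types (Omega : set 'rV[R]_n) (u : 'rV[R]_n -> R).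

Lemma gagliardo_ge0 s u : (0 <= gagliardo s u)%E.
Proof.
apply: integral_ge0 => x _; apply: integral_ge0 => y _.
by rewrite lee_fin divr_ge0 ?exprn_ge0// powR_ge0.
Qed.

Lemma Hs_norm_ge_L2 s u (e : R) : 0 < e -> (Hs_norm s u < e%:E)%E ->
  (\int[leb]_x (u x ^+ 2)%:E <= (e ^+ 2)%:E)%E.
Proof.
move=> e0; rewrite /Hs_norm Lnorm2_sqr => Hu.
have I0 : (0 <= \int[leb]_x (u x ^+ 2)%:E)%E.
  by apply: integral_ge0 => x _; rewrite lee_fin sqr_ge0.
rewrite leNgt; apply/negP => eI; move: Hu; apply/negP; rewrite -leNgt.
have -> : e%:E = ((e ^+ 2)%:E `^ 2^-1)%E.
  by rewrite poweR_EFin powR12_sqrt ?sqr_ge0// sqrtr_sqr gtr0_norm.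
have G0 := gagliardo_ge0 s u.
have le : ((e ^+ 2)%:E <= \int[leb]_x (u x ^+ 2)%:E + gagliardo s u)%E.
  by rewrite (le_trans (ltW eI))// leeDl.
apply: gt0_ler_poweR => //; rewrite in_itv /= leey andbT.
- by rewrite lee_fin sqr_ge0.
- exact: adde_ge0.
Qed.

(** Test functions vanish outside Omega, so the L^2 norm of u there is at most
its distance in H^s to any of them. *)
Lemma tHs_ae0 s Omega u : open Omega -> in_tHs s Omega u ->
  {ae leb, forall x, ~ Omega x -> u x = 0}.
Proof.
move=> oO [[uL _] approx].
have meas_u := Lfun_measurable uL.
have mO : measurable (~` Omega) by apply: measurableC; exact: open_measurable_rV.
have meas_u2 : measurable_fun setT (fun x => (u x ^+ 2)%:E).
  by apply/measurable_EFinP; exact: measurable_funX.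
have I0 : (\int[leb]_(x in ~` Omega) (u x ^+ 2)%:E = 0)%E.
  apply/eqP; rewrite eq_le integral_ge0 ?andbT; last first.
    by move=> x _; rewrite lee_fin sqr_ge0.
  apply/lee_addgt0Pr => e e0; rewrite add0e.
  have [|phi [sphi _ Kphi] uphi] := approx (Num.sqrt e); first by rewrite sqrtr_gt0.
  have := Hs_norm_ge_L2 _ uphi; rewrite sqrtr_gt0 (sqr_sqrtr (ltW e0)) => /(_ e0).
  apply: le_trans.
  have mphi : measurable_fun setT phi.
    by apply: continuous_measurable_rV; have [] := sphi [::].
  have mv2 : measurable_fun setT (fun x => ((u \- phi) x ^+ 2)%:E).
    by apply/measurable_EFinP; apply: measurable_funX; exact: measurable_funB.
  rewrite (eq_integral (fun x => ((u \- phi) x ^+ 2)%:E)).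
    apply: ge0_subset_integral => // x _.
    by rewrite lee_fin sqr_ge0.
  move=> x; rewrite inE /= => nOx; rewrite (_ : phi x = 0) ?subr0//.
  apply: contrapT => /eqP phix; apply: nOx; apply: Kphi.
  exact: subset_closure.
have meas_u2' : measurable_fun (~` Omega) (fun x => (u x ^+ 2)%:E).
  exact: measurable_funTS.
have : ae_eq leb (~` Omega) (fun x => (u x ^+ 2)%:E) (cst 0%E).
  apply/(ae_eq_integral_abs leb mO meas_u2').
  by rewrite -I0; apply: eq_integral => x _; rewrite gee0_abs// lee_fin sqr_ge0.
apply: filterS => x ux nOx; have /eqP := ux nOx.
by rewrite eqe sqrf_eq0 => /eqP.
Qed.

End tilde_Hs.

(** * Coercivity of the nonlocal form and sign of the coupling *)

Section geometry.
Context {R : realType} {n : nat}.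
Local Notation leb := (lebesgue_rV R n).
Implicit Types (Omega A B : set 'rV[R]_n).

Lemma coord_le_norm (x : 'rV[R]_n) i : `|x 0 i| <= `|x|.
Proof.
rewrite [leRHS]/Num.Def.normr /= mx_normrE; apply/bigmax_geP; right => /=.
by exists (0, i).
Qed.

Lemma norm_le_enorm (x : 'rV[R]_n) : `|x| <= enorm x.
Proof.
rewrite [leLHS]/Num.Def.normr /= mx_normrE; apply/bigmax_leP; split=> [|[i j] _] /=.
  exact: sqrtr_ge0.
by rewrite (ord1 i) enorm_ge_coord.
Qed.

Lemma bounded_coord A : bounded_set A ->
  exists2 b : R, 0 <= b & forall x, A x -> forall i, `|x 0 i| <= b.
Proof.
move=> [M [_ AM]]; exists (Num.max M 0 + 1).
  by rewrite addr_ge0// le_max lexx orbT.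
move=> x Ax i; apply: le_trans (coord_le_norm x i) _; apply: AM => //.
by rewrite (le_lt_trans (_ : M <= Num.max M 0)) ?le_max ?lexx// ltrDl.
Qed.

Lemma compact_closure_bounded A : bounded_set A -> compact (closure A).
Proof.
move=> /bounded_coord[b b0 Ab].
pose K := [set x : 'rV[R]_n | forall i, `[- b, b]%classic (x 0 i)].
have cK : compact K.
  by apply: (@rV_compact _ _ (fun=> `[- b, b]%classic)) => _; exact: segment_compact.
have AK : A `<=` K by move=> x Ax i; rewrite /= in_itv /= -ler_norml Ab.
have clK : closed K by apply: compact_closed cK; exact: norm_hausdorff.
apply: subclosed_compact cK _; first exact: closed_closure.
by rewrite (closure_id K).1//; exact: closureS.
Qed.

(** The sup distance attains its minimum on the product of the two compact
closures, and it bounds the Euclidean one from below. *)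
Lemma closure_dist_gt0 A B : A !=set0 -> B !=set0 ->
  bounded_set A -> bounded_set B -> closure A `&` closure B = set0 ->
  exists2 d : R, 0 < d & forall x y, A x -> B y -> d <= enorm (x - y).
Proof.
move=> [a Aa] [b Bb] bA bB AB.
pose f (z : 'rV[R]_n * 'rV[R]_n) : R := `|z.1 - z.2|.
have cf : continuous f.
  move=> z; apply: continuous_comp; last exact: norm_continuous.
  by apply: continuousB; [exact: cvg_fst|exact: cvg_snd].
have [| | |c /[!inE] -[cA cB] cmin] :=
    @compact_EVT_min _ R f (closure A `*` closure B).
- by exists (a, b); split; exact: subset_closure.
- by apply: compact_setX; exact: compact_closure_bounded.
- exact: continuous_subspaceT.
exists (f c).
  rewrite normr_gt0 subr_eq0; apply/eqP => c12.
  suff : (closure A `&` closure B) c.1 by rewrite AB.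
  by split; [exact: cA|rewrite c12; exact: cB].
move=> x y Ax By; apply: le_trans (norm_le_enorm _).
by apply: (cmin (x, y)); rewrite inE; split; exact: subset_closure.
Qed.

Definition cube (a b : R) : set 'rV[R]_n :=
  [set x | forall i : 'I_n, x 0 i \in `[a, b]].

Let measurable_side (a b : R) :
  measurable (`[a, b]%classic : set (measurableTypeR R)).
Proof. exact: measurable_itv. Qed.

Lemma measurable_cube a b : measurable (cube a b).
Proof. by apply: (measurable_row_box (fun=> measurable_side a b)). Qed.

Lemma lebesgue_rV_cube a b : a <= b -> leb (cube a b) = ((b - a) ^+ n)%:E.
Proof.
move=> ab; transitivity (\prod_(i < n) (b - a)%:E)%E; last first.
  by rewrite prodEFin prodr_const card_ord.
rewrite [LHS](lebesgue_rV_box (fun=> measurable_side a b)).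
apply: eq_bigr => i _; rewrite lebesgue_measure_itv /= lte_fin.
by case: ltgtP ab => // -> _; rewrite subrr.
Qed.

Lemma bounded_lebesgue_rV_lty A : measurable A -> bounded_set A ->
  (leb A < +oo)%E.
Proof.
move=> mA /bounded_coord[b b0 Ab]; apply: (@le_lt_trans _ _ (leb (cube (- b) b))).
  apply: le_measure; rewrite ?inE//; first exact: measurable_cube.
  by move=> x Ax i; rewrite in_itv /= -ler_norml Ab.
by rewrite lebesgue_rV_cube ?ltry// ge0_cp.
Qed.

End geometry.

Section coercivity.
Context {R : realType} {n : nat}.
Local Notation leb := (lebesgue_rV R n).
Implicit Types (Omega : set 'rV[R]_n) (u : 'rV[R]_n -> R).

(** A negative power rather than an inverse: measurability is then that of
[powR], and the value on the diagonal is still 0 when n + 2s is nonzero. *)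
Definition gagliardo_weight (s : R) (x y : 'rV[R]_n) : R :=
  enorm (x - y) `^ - (n%:R + 2 * s).

Lemma gagliardo_energy s u :
  gagliardo s u = energy leb u (gagliardo_weight s) setT setT.
Proof.
rewrite /gagliardo /energy.
apply: eq_integral => x _; apply: eq_integral => y _.
by rewrite /gagliardo_weight powRN real_normK// num_real.
Qed.

Lemma nonlocal_form_energy s A u :
  nonlocal_form s A u u = fine (energy leb u (gagliardo_weight s) A A).
Proof.
rewrite /nonlocal_form /dint /energy; congr fine.
apply: eq_integral => x _; apply: eq_integral => y _.
by rewrite /gagliardo_weight powRN expr2.
Qed.

Lemma measurable_gagliardo_weight s :
  measurable_fun setT (fun z : 'rV[R]_n * 'rV[R]_n => gagliardo_weight s z.1 z.2).
Proof.
apply: (measurableT_comp (measurable_powR _)).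
by apply: measurable_enorm; apply: measurable_fun_subrV.
Qed.

(** The two energy estimates with [O] the domain, [B] the other domain and [S] the
unit cube of corner b + 1, where every coordinate of a point of either domain
is at most b in absolute value: its points differ from those of the domains by
between 1 and 2b + 2 in each coordinate. *)
Lemma nonlocal_form_coercive (s : R) (Omega Omega' : set 'rV[R]_n) :
  (0 < n)%N -> 0 <= s -> bounded_domain Omega -> bounded_domain Omega' ->
  closure Omega `&` closure Omega' = set0 ->
  exists2 K : R, 0 < K & forall u, in_tHs s Omega u ->
    fine (\int[leb]_x (u x ^+ 2)%:E)%E <= K * nonlocal_form s (~` Omega') u u /\
    fine (gagliardo s u) <= K * nonlocal_form s (~` Omega') u u.
Proof.
move=> n0 s0 [neO oO _ bO] [neO' oO' _ bO'] OO'.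
set p := n%:R + 2 * s; have p0 : 0 < p by rewrite ltr_wpDr ?ltr0n// mulr_ge0.
have mO := open_measurable_rV oO; have mO' := open_measurable_rV oO'.
have [d d0 dOO'] := closure_dist_gt0 neO neO' bO bO' OO'.
have [b1 b10 Ob] := bounded_coord bO; have [b2 b20 O'b] := bounded_coord bO'.
pose b := b1 + b2.
pose S : set 'rV[R]_n := cube (b + 1) (b + 2).
have mS : measurable S by exact: measurable_cube.
have S1 : leb S = 1%E.
  rewrite lebesgue_rV_cube; last by lra.
  by rewrite (_ : _ - _ = 1) ?expr1n//; ring.
have i0 : 'I_n := Ordinal n0.
have far (x y : 'rV[R]_n) i : S y -> `|x 0 i| <= b -> 1 <= `|(x - y) 0 i| <= 2 * b + 2.
  move=> /(_ i); rewrite in_itv /= !mxE => /andP[y1 y2]; rewrite ler_norml => /andP[x1 x2].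
  rewrite ler0_norm; last by lra.
  by apply/andP; split; lra.
have Ob' x i : Omega x -> `|x 0 i| <= b.
  by move=> Ox; apply: le_trans (Ob x Ox i) _; rewrite lerDl.
have O'b' x i : Omega' x -> `|x 0 i| <= b.
  by move=> Ox; apply: le_trans (O'b x Ox i) _; rewrite lerDr.
have notS (x : 'rV[R]_n) : `|x 0 i0| <= b -> ~ S x.
  by move=> xb Sx; have := far _ _ _ Sx xb; rewrite subrr mxE normr0 ler10.
have OS : Omega `&` S = set0.
  by apply/seteqP; split=> // x [xO]; apply: notS; exact: Ob'.
have OO'0 : Omega `&` Omega' = set0.
  apply/seteqP; split=> // x [xO O'x]; rewrite -OO'.
  by split; exact: subset_closure.
have OA : Omega `<=` ~` Omega'.
  by move=> x Ox O'x; have : (Omega `&` Omega') x by []; rewrite OO'0.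
have SA : S `<=` ~` Omega' by move=> x + O'x; apply: notS; exact: O'b'.
have b0 : 0 <= b by rewrite addr_ge0.
pose M := Num.sqrt n%:R * (2 * b + 2).
have M0 : 0 < M by rewrite mulr_gt0 ?sqrtr_gt0 ?ltr0n//; lra.
have antitone (x y : R) : 0 < x -> x <= y -> y `^ (- p) <= x `^ (- p).
  move=> x0 xy; have y0 := lt_le_trans x0 xy.
  rewrite !powRN lef_pV2 ?posrE ?powR_gt0//.
  by apply: ge0_ler_powR => //; rewrite ?nnegrE ltW.
pose m := M `^ (- p); have m0 : 0 < m by exact: powR_gt0.
pose N := d `^ (- p); have N0 : 0 < N by exact: powR_gt0.
have lower x y : Omega x -> S y -> m <= gagliardo_weight s x y.
  move=> Ox Sy; apply: antitone.
    have /andP[h _] := far _ _ i0 Sy (Ob' _ i0 Ox).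
    by apply: lt_le_trans (enorm_ge_coord _ i0); exact: lt_le_trans h.
  apply: enorm_le_coord; first by lra.
  by move=> i; have /andP[] := far _ _ i Sy (Ob' _ i Ox).
have enormN (z : 'rV[R]_n) : enorm (- z) = enorm z.
  by congr Num.sqrt; apply: eq_bigr => i _; rewrite mxE sqrrN.
have upper x y : Omega x -> Omega' y ->
    gagliardo_weight s x y <= N /\ gagliardo_weight s y x <= N.
  move=> Ox O'y; rewrite /gagliardo_weight -(opprB x y) enormN.
  by have h := antitone _ _ d0 (dOO' _ _ Ox O'y).
have muO' : leb Omega' \is a fin_num.
  by rewrite ge0_fin_numE//; exact: bounded_lebesgue_rV_lty.
pose V := fine (leb Omega'); have V0 : 0 <= V by exact: fine_ge0.
pose K := m^-1 + 1 + 2 * N * V * m^-1.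
have NV0 : 0 <= 2 * N * V by rewrite !mulr_ge0// ltW.
have K0 : 0 < K.
  by rewrite ltr_wpDr ?addr_gt0 ?invr_gt0// mulr_ge0// invr_ge0 ltW.
have arith (g i e : R) : 0 <= e -> m * i <= e -> g <= e + 2 * N * V * i ->
    i <= K * e /\ g <= K * e.
  move=> e0 mie gle.
  have ie : i <= m^-1 * e by rewrite mulrC ler_pdivlMr// mulrC.
  have := ler_wpM2l NV0 ie; rewrite mulrA => ie'.
  have me0 : 0 <= m^-1 * e by rewrite mulr_ge0// invr_ge0 ltW.
  have NVe0 : 0 <= 2 * N * V * m^-1 * e.
    by rewrite mulr_ge0// mulr_ge0// invr_ge0 ltW.
  by rewrite /K !mulrDl mul1r; split; lra.
exists K => // {K0}; clearbody K.
move=> u uH; have [[uL ulty] _] := uH.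
have meas_u := Lfun_measurable uL.
have u0 := tHs_ae0 oO uH.
have w0 x y : 0 <= gagliardo_weight s x y by exact: powR_ge0.
have mw := measurable_gagliardo_weight s.
have mA : measurable (~` Omega') by exact: measurableC.
have E0 A : (0 <= energy leb u (gagliardo_weight s) A A)%E.
  apply: integral_ge0 => x _; apply: integral_ge0 => y _.
  by rewrite lee_fin mulr_ge0// sqr_ge0.
have := energy_poincare meas_u w0 mw mO u0 mA mS OA SA OS (ltW m0) lower.
have := energy_localize meas_u w0 mw u0 mO' OO'0 (ltW N0) upper.
have := le_energy leb meas_u w0 mw mA.
rewrite S1 mule1 -gagliardo_energy nonlocal_form_energy.
have Gfin : gagliardo s u \is a fin_num.
  by rewrite (ge0_fin_numE (gagliardo_ge0 s u)).
have Ifin := Lfun2_fin_num uL.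
move=> EG; have Efin : energy leb u (gagliardo_weight s) (~` Omega') (~` Omega') \is a fin_num.
  by rewrite (ge0_fin_numE (E0 _)); exact: le_lt_trans EG ulty.
have e0 := fine_ge0 (E0 (~` Omega')).
rewrite -(fineK Gfin) -(fineK Ifin) -(fineK Efin) -(fineK muO') -!EFinM -EFinD.
rewrite !lee_fin => h1 h2; exact: arith e0 h2 h1.
Qed.

End coercivity.

(** The sign of J is known only a.e., so the inner integral is replaced by that of
the absolute value, which is legitimate for every x since reflections preserve
null sets. *)
Lemma coupling_ge0 {R : realType} {n : nat} (Omega1 Omega2 : set 'rV[R]_n)
    (J u1 u2 : 'rV[R]_n -> R) :
  measurable Omega2 ->
  {ae lebesgue_rV R n, forall z, 0 <= J z} -> measurable_fun setT J ->
  measurable_fun setT u2 ->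
  0 <= dint Omega1 Omega2
         (fun x y => J (x - y) * (u1 x - u2 y) * (u1 x - u2 y)).
Proof.
move=> mO2 J0 mJ meas_u2; apply: fine_ge0; apply: integral_ge0 => x _.
have mF : measurable_fun Omega2
    (fun y => (J (x - y) * (u1 x - u2 y) * (u1 x - u2 y))%:E).
  apply: measurable_funTS; apply/measurable_EFinP.
  have mxu : measurable_fun setT (fun y => u1 x - u2 y) by exact: measurable_funB.
  apply: measurable_funM => //; apply: measurable_funM => //.
  by apply: (measurableT_comp mJ); apply: measurable_fun_subrV.
rewrite (ae_eq_integral
  (fun y : 'rV[R]_n => `|(J (x - y) * (u1 x - u2 y) * (u1 x - u2 y))%:E|)%E)//.
- by apply: integral_ge0.
- exact: measurableT_comp.
apply: filterS (ae_reflect x J0) => y Jy _; rewrite gee0_abs// lee_fin.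
by rewrite -mulrA mulr_ge0// -expr2 sqr_ge0.
Qed.

(** * Stability bound *)

(** The left side controls a square and the right side is linear in the same
quantity, which therefore can be divided out. *)
Lemma quadratic_absorption {R : realType} (k1 k2 K1 K2 : R) :
  0 < k1 -> 0 < k2 -> 0 < K1 -> 0 < K2 ->
  exists2 C : R, 0 < C &
    forall E1 E2 j I1 I2 G1 G2 a1 a2 : R,
      0 <= I1 -> 0 <= I2 -> 0 <= j -> 0 <= a1 -> 0 <= a2 ->
      I1 <= K1 * E1 /\ G1 <= K1 * E1 -> I2 <= K2 * E2 /\ G2 <= K2 * E2 ->
      k1 * E1 + k2 * E2 + j <= a1 * Num.sqrt I1 + a2 * Num.sqrt I2 ->
      Num.sqrt G1 + Num.sqrt G2 <= C * (a1 + a2).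
Proof.
move=> k10 k20 K10 K20.
pose c := Num.min (k1 / K1) (k2 / K2).
have c0 : 0 < c by rewrite lt_min !divr_gt0.
exists (2 / c); first exact: divr_gt0.
move=> E1 E2 j I1 I2 G1 G2 a1 a2 I10 I20 j0 a10 a20 [IE1 GE1] [IE2 GE2] le.
have D1 := le_trans I10 IE1; have D2 := le_trans I20 IE2.
(* q_i dominates both the square root of I_i and that of G_i *)
pose q1 := Num.sqrt (K1 * E1); pose q2 := Num.sqrt (K2 * E2).
have q10 : 0 <= q1 by exact: sqrtr_ge0.
have q20 : 0 <= q2 by exact: sqrtr_ge0.
have e1 : c * q1 ^+ 2 <= k1 * E1.
  have -> : k1 * E1 = k1 / K1 * (K1 * E1) by rewrite mulrA divfK// gt_eqF.
  by rewrite sqr_sqrtr// ler_wpM2r// ge_min lexx.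
have e2 : c * q2 ^+ 2 <= k2 * E2.
  have -> : k2 * E2 = k2 / K2 * (K2 * E2) by rewrite mulrA divfK// gt_eqF.
  by rewrite sqr_sqrtr// ler_wpM2r// ge_min lexx orbT.
have t1 : a1 * Num.sqrt I1 <= a1 * q1 by rewrite ler_wpM2l// ler_wsqrtr.
have t2 : a2 * Num.sqrt I2 <= a2 * q2 by rewrite ler_wpM2l// ler_wsqrtr.
apply: le_trans (lerD (ler_wsqrtr GE1) (ler_wsqrtr GE2)) _; rewrite -/q1 -/q2.
have main : c * (q1 ^+ 2 + q2 ^+ 2) <= a1 * q1 + a2 * q2.
  by rewrite mulrDr; lra.
rewrite mulrAC ler_pdivlMr//.
have [q0|q0] := ltP 0 (q1 + q2); last first.
  have -> : q1 + q2 = 0 by lra.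
  by rewrite mul0r mulr_ge0// addr_ge0.
(* c (q1 + q2)^2 <= 2 c (q1^2 + q2^2) <= 2 (a1 + a2) (q1 + q2) *)
rewrite -(ler_pM2r q0).
have : 0 <= c * (q1 - q2) ^+ 2 by rewrite mulr_ge0 ?sqr_ge0 ?ltW.
have : 0 <= a1 * q2 by rewrite mulr_ge0.
have : 0 <= a2 * q1 by rewrite mulr_ge0.
nra.
Qed.

Theorem theorem3p7 (R : realType) (n : nat) (hn : (2 <= n)%N)
  (s1 s2 : R) (hs1 : 0 < s1 < 1) (hs2 : 0 < s2 < 1)
  (Omega1 Omega2 : set 'rV[R]_n)
  (hO1 : bounded_domain Omega1) (hO2 : bounded_domain Omega2)
  (lO1 : lipschitz_boundary Omega1) (lO2 : lipschitz_boundary Omega2)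
  (hO12 : closure Omega1 `&` closure Omega2 = set0)
  (J : 'rV[R]_n -> R)
  (J_ge0 : {ae lebesgue_rV R n, forall z, 0 <= J z})
  (J_even : {ae lebesgue_rV R n, forall z, J z = J (- z)})
  (J_L1 : (lebesgue_rV R n).-integrable setT (EFin \o J))
  (J_supp : exists2 r, set_dist Omega1 Omega2 < r & eball 0 r `<=` ess_support J) :
  exists2 C : R, 0 < C &
    forall f1 f2 : 'rV[R]_n -> R, in_L2 Omega1 f1 -> in_L2 Omega2 f2 ->
    forall u : ('rV[R]_n -> R) * ('rV[R]_n -> R),
      weak_solution s1 s2 Omega1 Omega2 J f1 f2 u ->
      tHs_norm s1 u.1 + tHs_norm s2 u.2
        <= C * (L2_norm Omega1 f1 + L2_norm Omega2 f2).
Proof.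
have n0 : (0 < n)%N by exact: leq_trans hn.
have /andP[s1_gt0 _] := hs1; have /andP[s2_gt0 _] := hs2.
have [_ oO1 _ _] := hO1; have [_ oO2 _ _] := hO2.
have mO1 := open_measurable_rV oO1; have mO2 := open_measurable_rV oO2.
have [K1 K1_gt0 coer1] := nonlocal_form_coercive n0 (ltW s1_gt0) hO1 hO2 hO12.
have hO21 : closure Omega2 `&` closure Omega1 = set0 by rewrite setIC.
have [K2 K2_gt0 coer2] := nonlocal_form_coercive n0 (ltW s2_gt0) hO2 hO1 hO21.
have c1_gt0 := frac_lap_const_gt0 n hs1; have c2_gt0 := frac_lap_const_gt0 n hs2.
have half (t : R) : 0 < t -> 0 < t / 2 by move=> t0; rewrite divr_gt0.
have [C C0 absorb] := quadratic_absorption (half _ c1_gt0) (half _ c2_gt0) K1_gt0 K2_gt0.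
exists C; first exact: C0.
move=> f1 f2 f1L f2L [u1 u2] [[/= u1H u2H] /(_ (u1, u2) (conj u1H u2H))].
rewrite /form_A /tHs_norm /= => eqA.
have [[u1L _] _] := u1H; have [[u2L _] _] := u2H.
have mJ : measurable_fun setT J.
  by apply/measurable_EFinP; exact: measurable_int J_L1.
have int_sqr_ge0 (v : 'rV[R]_n -> R) :
    0 <= fine (\int[lebesgue_rV R n]_x (v x ^+ 2)%:E)%E.
  by apply: fine_ge0; apply: integral_ge0 => x _; rewrite lee_fin sqr_ge0.
have L2_ge0 (Omega : set 'rV[R]_n) f : 0 <= L2_norm Omega f.
  by apply: fine_ge0; exact: Lnorm_ge0.
apply: (absorb _ _ _ _ _ _ _ _ _ (int_sqr_ge0 u1) (int_sqr_ge0 u2)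
  (coupling_ge0 Omega1 u1 mO2 J_ge0 mJ (Lfun_measurable u2L))
  (L2_ge0 Omega1 f1) (L2_ge0 Omega2 f2) (coer1 _ u1H) (coer2 _ u2H)).
rewrite eqA; apply: lerD.
- exact: Rintegral_cauchy_schwarz mO1 f1L u1L.
- exact: Rintegral_cauchy_schwarz mO2 f2L u2L.
Qed.
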